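(* Let $a$ and $b$ be coprime nonzero integers and let $\ell=2^\beta d$ be a positive integer such that $d$ is odd and $\beta\ge 0$. Then the following hold. 1. If $ab$ is odd, then $\ell=2^\beta d\in OG_{(a,b)}$ if and only if one of the following statements holds: (a) $\beta\in\{0,1\}$ and $d=1$; (b) $\beta\in\{0,1\}$, $d\ge 3$, and $2\| \mathrm{ord}_p(\frac{a}{b})$ for every prime $p$ dividing $d$; (c) $\beta\ge 2$, $d=1$ and $2^\beta\mid (a+b)$; (d) $\beta\ge 2$, $d\ge 3$, $2^\beta\mid (a+b)$, and $d\in G_{(a,b)}$ is such that $2\|\mathrm{ord}_d(\frac{a}{b})$. 2. If $ab$ is even, then $\ell=2^\beta d\in OG_{(a,b)}$ if and only if one of the following statements holds: (a) $\beta=0$ and $d=1$; (b) $\beta=0$, $d\ge 3$, and $2\|\mathrm{ord}_p(\frac{a}{b})$ for every prime $p$ dividing $d$.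
   Context: For coprime nonzero integers $a,b$, $G_{(a,b)}$ denotes the set of positive integers $d$ such that $d\mid a^k+b^k$ for some integer $k\ge 1$ (good integers), and $OG_{(a,b)}$ denotes the set of positive integers $d$ such that $d\mid a^k+b^k$ for some odd integer $k\ge 1$ (oddly-good integers). For a positive integer $n$ coprime to both $a$ and $b$, $\mathrm{ord}_n(\frac{a}{b})$ denotes the multiplicative order of $ab^{-1}$ in $(\mathbb{Z}/n\mathbb{Z})^\times$. The notation $2^s\| N$ means that $s$ is the largest integer with $2^s\mid N$. A condition of the form $2\|\mathrm{ord}_n(\frac{a}{b})$ is understood to include that $n$ is coprime to $ab$ (so that the order is defined). *)

(* Defs.v *)
From HB Require Import structures.
From mathcomp Require Import all_boot all_order all_algebra all_fingroup.

Set Implicit Arguments.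
Unset Strict Implicit.
Unset Printing Implicit Defensive.

Import GRing.Theory.
Local Open Scope ring_scope.

Definition good (a b : int) (d : nat) : Prop :=
  (0 < d)%N /\ exists k : nat, (1 <= k)%N /\ (d%:Z %| a ^+ k + b ^+ k)%Z.

Definition oddly_good (a b : int) (d : nat) : Prop :=
  (0 < d)%N /\
  exists k : nat, [/\ (1 <= k)%N, odd k & (d%:Z %| a ^+ k + b ^+ k)%Z].

(* The class of a b^-1 in (Z/nZ)^*; the default value 1 is only taken when
   a or b is not coprime to n. *)
Definition ratio_unit (n : nat) (a b : int) : {unit 'Z_n} :=
  insubd (1%g : {unit 'Z_n}) (a%:~R / b%:~R : 'Z_n).

(* Meaningful for n > 0 coprime to a and b.  Although 'Z_1 is Z/2Z, the value
   at n = 1 is the expected 1, since Z/2Z has a trivial unit group. *)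
Definition ord_ratio (n : nat) (a b : int) : nat := #[ratio_unit n a b]%g.

(* 2^s || N *)
Definition pow2_exact (s N : nat) : Prop :=
  (2 ^ s %| N)%N /\ forall t : nat, (2 ^ t %| N)%N -> (t <= s)%N.

(* 2 || ord_n(a/b), which presupposes that the order is defined. *)
Definition two_exact_ord (n : nat) (a b : int) : Prop :=
  [/\ coprimez n%:Z a, coprimez n%:Z b & pow2_exact 1 (ord_ratio n a b)].

(* Main.v *)
(** The order of [a/b] modulo [n] divides [k] iff [n] divides [a^k - b^k].  So if [n >= 3]
    divides [a^k + b^k], that order divides [2k] but not [k]; this relates the parity
    of [k] to the exact power of 2 in the order.  Oddly-good odd integers are built up one
    prime [p] at a time: if both [e] and [p] divide [A + B], then [p * e] divides
    [A^p + B^p].  The power of 2 is controlled by the cofactor of [a + b] in [a^k + b^k],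
    which is odd when [k], [a] and [b] are. *)

Require Import Defs.
From HB Require Import structures.
From mathcomp Require Import all_boot all_order all_algebra all_fingroup.
From mathcomp Require Import cyclic ring zify.

Set Implicit Arguments.
Unset Strict Implicit.
Unset Printing Implicit Defensive.

Import GRing.Theory.
Local Open Scope ring_scope.

(** * The order of [a/b] and divisibility of [a^k - b^k] *)

Lemma intr_Zp_eq0 (n : nat) (z : int) :
  (1 < n)%N -> ((z%:~R : 'Z_n) == 0) = (n%:Z %| z)%Z.
Proof.
move=> n1; have natE m : ((m%:R : 'Z_n) == 0) = (n %| m)%N.
  by rewrite -val_eqE /= val_Zp_nat.
case: z => m; first by rewrite natE dvdzE.
by rewrite NegzE rmorphN /= oppr_eq0 natE dvdzE.
Qed.

Lemma unit_intr_Zp (n : nat) (z : int) :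
  (1 < n)%N -> coprimez n%:Z z -> (z%:~R : 'Z_n) \is a GRing.unit.
Proof.
move=> n1; rewrite coprimezE /=; case: z => m /=; first by rewrite unitZpE.
by rewrite NegzE rmorphN /= unitrN unitZpE.
Qed.

Lemma ord_ratio_dvd (n : nat) (a b : int) (k : nat) :
  (1 < n)%N -> coprimez n%:Z a -> coprimez n%:Z b ->
  (ord_ratio n a b %| k)%N = (n%:Z %| a ^+ k - b ^+ k)%Z.
Proof.
move=> n1 na nb.
have ua := unit_intr_Zp n1 na; have ub := unit_intr_Zp n1 nb.
rewrite /ord_ratio order_dvdn -val_eqE FinRing.val_unitX /ratio_unit.
(* Since [a/b] is a unit here, the default of [insubd] is not taken. *)
rewrite val_insubd /= unitrM unitrV ua ub /= expr_div_n.
rewrite -intr_Zp_eq0 // rmorphB /= !rmorphXn /= subr_eq0.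
have ubk : (b%:~R : 'Z_n) ^+ k \is a GRing.unit by rewrite unitrX.
by rewrite -(can_eq (mulrK ubk)) divrK // mul1r.
Qed.

Lemma pow2_exact1P (N : nat) :
  pow2_exact 1 N <-> exists2 m : nat, odd m & N = (2 * m)%N.
Proof.
split=> [[/dvdnP[m ->]] H|[m om ->]].
  exists m; last by rewrite mulnC.
  apply: contraT; rewrite -dvdn2 => m2.
  by have := H 2; rewrite (dvdn_mul m2) // => /(_ isT).
split; first exact: dvdn_mulr.
case=> [|[|t]] // H.
have : (2 * 2 %| 2 * m)%N by apply: dvdn_trans H; rewrite !expnS mulnA dvdn_mulr.
by rewrite dvdn_pmul2l // dvdn2 om.
Qed.

(** * Divisors of [a^k + b^k]: parity of [k] against the order *)

Lemma coprimez_dvd_sum (n : nat) (a b : int) (k : nat) :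
  coprimez a b -> (0 < k)%N -> (n%:Z %| a ^+ k + b ^+ k)%Z ->
  coprimez n%:Z a /\ coprimez n%:Z b.
Proof.
move=> ab k0 nk.
have abk : coprimez (a ^+ k) (b ^+ k) by rewrite coprimezXl // coprimezXr.
have gen c : coprimez (a ^+ k + b ^+ k) (c ^+ k) -> coprimez n%:Z c.
  by move=> /(coprimez_dvdl nk); rewrite coprimez_pexpr.
split; apply: gen; rewrite /coprimez.
  by rewrite gcdzC addrC gcdzDr.
by rewrite gcdzC gcdzDr gcdzC.
Qed.

(** Otherwise [n] divides the total [2 * a^k], hence 2, as [a] is invertible modulo [n]. *)
Lemma dvdz_sum_sub (n : nat) (a b : int) (k : nat) :
  (2 < n)%N -> coprimez n%:Z a ->
  (n%:Z %| a ^+ k + b ^+ k)%Z -> ~~ (n%:Z %| a ^+ k - b ^+ k)%Z.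
Proof.
move=> n2 na H1; apply/negP => H2.
have : (n%:Z %| 2 * a ^+ k)%Z.
  have -> : 2 * a ^+ k = (a ^+ k + b ^+ k) + (a ^+ k - b ^+ k) by ring.
  exact: rpredD.
rewrite Gauss_dvdzl; last by rewrite coprimezXr.
by rewrite dvdzE /= => /dvdn_leq; lia.
Qed.

Lemma dvdz_sum_sub2 (n : nat) (a b : int) (k : nat) :
  (n%:Z %| a ^+ k + b ^+ k)%Z -> (n%:Z %| a ^+ (2 * k) - b ^+ (2 * k))%Z.
Proof. by move=> H; rewrite mulnC !exprM subr_sqr dvdz_mull. Qed.

(** An odd order dividing [2k] would divide [k]. So the order is [2m], and [m] divides the odd
    [k]. *)
Lemma two_exact_ord_odd_sum (n : nat) (a b : int) (k : nat) :
  (2 < n)%N -> coprimez a b -> odd k -> (n%:Z %| a ^+ k + b ^+ k)%Z ->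
  two_exact_ord n a b.
Proof.
move=> n2 ab ok nk; have [na nb] := coprimez_dvd_sum ab (odd_gt0 ok) nk.
have ordE j := ord_ratio_dvd j (ltnW n2) na nb.
split=> //; apply/pow2_exact1P.
have := dvdz_sum_sub2 nk; rewrite -ordE => d2k.
have := dvdz_sum_sub n2 na nk; rewrite -ordE.
case: (boolP (odd (ord_ratio n a b))) => oo.
  by move: d2k; rewrite Gauss_dvdr ?coprimen2 // => ->.
move: oo; rewrite -dvdn2 => /dvdnP[m Em] _.
exists m; last by rewrite Em mulnC.
move: d2k; rewrite Em mulnC dvdn_pmul2l // => mk.
exact: dvdn_odd mk ok.
Qed.

(** With order [2m], [m] odd, [m] divides [k]; an even [k] would then be a multiple of [2m]. This
    upgrades good to oddly-good. *)
Lemma two_exact_ord_sum_odd (n : nat) (a b : int) (k : nat) :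
  (2 < n)%N -> two_exact_ord n a b -> (n%:Z %| a ^+ k + b ^+ k)%Z -> odd k.
Proof.
move=> n2 [na nb /pow2_exact1P[m om Em]] nk.
have ordE j := ord_ratio_dvd j (ltnW n2) na nb.
have := dvdz_sum_sub2 nk; rewrite -ordE Em dvdn_pmul2l // => mk.
have := dvdz_sum_sub n2 na nk; rewrite -ordE Em.
by rewrite Gauss_dvd ?coprime2n // mk andbT dvdn2 negbK.
Qed.

(** With order [2m], the prime [p] divides [(a^m - b^m)(a^m + b^m)], but not the first factor
    because [2m > m]. *)
Lemma prime_two_exact_ord_sum (p : nat) (a b : int) :
  prime p -> two_exact_ord p a b ->
  exists2 m : nat, odd m & (p%:Z %| a ^+ m + b ^+ m)%Z.
Proof.
move=> pp [pa pb /pow2_exact1P[m om Em]].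
have ordE j := ord_ratio_dvd j (prime_gt1 pp) pa pb.
exists m => //.
have : (p%:Z %| a ^+ (2 * m) - b ^+ (2 * m))%Z by rewrite -ordE Em.
rewrite mulnC !exprM subr_sqr dvdzE abszM Euclid_dvdM //.
case/orP; last by rewrite dvdzE.
have := ordE m; rewrite dvdzE => <-; rewrite Em => /dvdn_leq.
by move/(_ (odd_gt0 om)); have := odd_gt0 om; lia.
Qed.

(** * Odd exponents and the construction of odd oddly-good integers *)

Lemma sum_exp_odd (R : comNzRingType) (a b : R) (k : nat) :
  odd k -> a ^+ k + b ^+ k =
           (a + b) * \sum_(i < k) a ^+ (k.-1 - i) * (- b) ^+ i.
Proof.
move=> ok; have := subrXX a (- b) k; rewrite opprK.
by rewrite exprNn -signr_odd ok expr1 mulN1r opprK => ->.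
Qed.

Lemma dvdz_sum_exp_odd (a b : int) (k j : nat) :
  odd j -> (a ^+ k + b ^+ k %| a ^+ (k * j) + b ^+ (k * j))%Z.
Proof. by move=> oj; rewrite !exprM sum_exp_odd // dvdz_mulr. Qed.

(** The factor [A + B] supplies [e] and its cofactor supplies [p]. Since [e] may be a multiple of
    [p], repeated primes are covered. *)
Lemma dvdz_lift_prime (p : nat) (A B : int) (e : nat) :
  odd p -> (p%:Z %| A + B)%Z -> (e%:Z %| A + B)%Z ->
  ((p * e)%N%:Z %| A ^+ p + B ^+ p)%Z.
Proof.
move=> op pAB eAB; rewrite sum_exp_odd // PoszM mulrC dvdz_mul //.
(* Modulo [A + B] the cofactor is [p * A^(p-1)]. *)
have AB i : (p%:Z %| (- B) ^+ i - A ^+ i)%Z.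
  by rewrite subrXX dvdz_mulr // -opprD rpredN addrC.
have -> : \sum_(i < p) A ^+ (p.-1 - i) * (- B) ^+ i =
   \sum_(i < p) A ^+ (p.-1 - i) * ((- B) ^+ i - A ^+ i) + A ^+ p.-1 *+ p.
  rewrite -[p in _ *+ p]card_ord -sumr_const -big_split /=.
  apply: eq_bigr => i _; rewrite mulrBr -exprD subnK ?subrK //.
  by have := ltn_ord i; lia.
rewrite rpredD //; last by rewrite -mulr_natr dvdz_mull // natz.
by rewrite rpred_sum // => i _; rewrite dvdz_mull.
Qed.

Lemma odd_primes_oddly_good (a b : int) (d : nat) : odd d ->
  (forall p : nat, prime p -> (p %| d)%N -> two_exact_ord p a b) ->
  oddly_good a b d.
Proof.
move=> od H; split; first exact: odd_gt0.
have [n] := ubnP d; elim: n d od H => // n IHn d od H dn.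
have [d1|d1] := leqP d 1.
  by exists 1%N; split=> //; rewrite (_ : d = 1%N) ?dvd1z //; case: d od d1 {H dn} => [|[]].
have pp := pdiv_prime d1; have /dvdnP[e Ed] := pdiv_dvd d.
set p := pdiv d in pp Ed; have pd : (p %| d)%N := pdiv_dvd d.
have op : odd p := dvdn_odd pd od.
have ed : (e %| d)%N by rewrite Ed dvdn_mulr.
have [||k [k1 ok ek]] := IHn e (dvdn_odd ed od).
- by move=> q qp /dvdn_trans/(_ ed); apply: H.
- have := prime_gt1 pp; have := odd_gt0 (dvdn_odd ed od).
  by move: dn; rewrite Ed; nia.
have [m om pm] := prime_two_exact_ord_sum pp (H p pp pd).
(* [k] serves [e] and [m] serves [p]. As both are odd, [e] and [p] divide the sum with exponent
   [k * m], and the last factor [p] lifts to [p * e]. *)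
exists (k * m * p)%N; split.
- by rewrite !muln_gt0 k1 !odd_gt0.
- by rewrite !oddM ok om op.
rewrite Ed (mulnC e) !(exprM _ (k * m)%N); apply: dvdz_lift_prime => //.
- by apply: dvdz_trans pm _; rewrite (mulnC k); apply: dvdz_sum_exp_odd.
- by apply: dvdz_trans ek _; apply: dvdz_sum_exp_odd.
Qed.

(** * Parity and the power of 2 *)

Lemma dvd2z_add (a b : int) : (2 %| a + b)%Z = ((2 %| a)%Z == (2 %| b)%Z).
Proof. lia. Qed.

Lemma dvd2z_exp (a : int) (k : nat) : (0 < k)%N -> (2 %| a ^+ k)%Z = (2 %| a)%Z.
Proof. by move=> k0; rewrite !dvdzE abszX Euclid_dvdX // k0 andbT. Qed.

Lemma dvd2z_mul (a b : int) : (2 %| a * b)%Z = (2 %| a)%Z || (2 %| b)%Z.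
Proof. by rewrite !dvdzE abszM Euclid_dvdM. Qed.

Lemma dvdz_pow2_sum (a b : int) (beta k : nat) :
  ~~ (2 %| a * b)%Z -> odd k ->
  ((2 ^ beta)%N%:Z %| a ^+ k + b ^+ k)%Z = ((2 ^ beta)%N%:Z %| a + b)%Z.
Proof.
rewrite dvd2z_mul negb_or => /andP[a2 b2] ok.
apply/idP/idP; last by rewrite sum_exp_odd //; apply: dvdz_mulr.
rewrite sum_exp_odd // Gauss_dvdzl // coprimezE coprimeXl // coprime2n.
rewrite -[odd _]negbK -dvdn2 -(dvdzE 2).
(* Each of the [k] terms is odd: subtracting 1 from each leaves an even sum plus the odd [k]. *)
have -> : \sum_(i < k) a ^+ (k.-1 - i) * (- b) ^+ i =
   \sum_(i < k) (a ^+ (k.-1 - i) * (- b) ^+ i - 1) + k%:Z.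
  by rewrite sumrB sumr_const card_ord natz subrK.
rewrite dvd2z_add rpred_sum => [|i _]; first by rewrite dvdzE /= dvdn2 ok.
have e2 (c : int) j : ~~ (2 %| c)%Z -> ~~ (2 %| c ^+ j)%Z.
  by case: j => // j; rewrite dvd2z_exp.
have := e2 a (k.-1 - i)%N a2; have := e2 (- b) i; rewrite rpredN => /(_ b2).
set x := (- b) ^+ i; set y := a ^+ _ => x2 y2.
by rewrite dvd2z_add dvd2z_mul (negbTE x2) (negbTE y2).
Qed.

Lemma dvdz_pow2_mul (beta d : nat) (z : int) : odd d ->
  ((2 ^ beta * d)%N%:Z %| z)%Z = ((2 ^ beta)%N%:Z %| z)%Z && (d%:Z %| z)%Z.
Proof. by move=> od; rewrite !dvdzE /= Gauss_dvd // coprimeXl // coprime2n. Qed.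

Lemma oddly_good_odd_primes (a b : int) (d p : nat) :
  coprimez a b -> odd d -> oddly_good a b d ->
  prime p -> (p %| d)%N -> two_exact_ord p a b.
Proof.
move=> ab od [_ [k [k1 ok dk]]] pp pd.
apply: two_exact_ord_odd_sum ab ok _; first by rewrite odd_prime_gt2 // (dvdn_odd pd).
by apply: dvdz_trans dk; rewrite dvdzE.
Qed.

Theorem theorem3p1 (a b : int) (l beta d : nat)
    (ha : a != 0) (hb : b != 0) (hab : coprimez a b)
    (hl0 : (0 < l)%N) (hl : l = (2 ^ beta * d)%N) (hd : odd d) :
  (~~ (2 %| a * b)%Z ->
     (oddly_good a b l <->
        [\/ (beta = 0%N \/ beta = 1%N) /\ d = 1%N,
            [/\ beta = 0%N \/ beta = 1%N, (3 <= d)%N &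
                forall p : nat, prime p -> (p %| d)%N -> two_exact_ord p a b],
            [/\ (2 <= beta)%N, d = 1%N & ((2 ^ beta)%N%:Z %| a + b)%Z] |
            [/\ (2 <= beta)%N, (3 <= d)%N, ((2 ^ beta)%N%:Z %| a + b)%Z &
                good a b d /\ two_exact_ord d a b]]))
  /\
  ((2 %| a * b)%Z ->
     (oddly_good a b l <->
        ((beta = 0%N /\ d = 1%N) \/
         [/\ beta = 0%N, (3 <= d)%N &
             forall p : nat, prime p -> (p %| d)%N -> two_exact_ord p a b]))).
Proof.
subst l; have d1or : d = 1%N \/ (3 <= d)%N by case: (d) hd => [|[|[]]]; auto.
have og1 : oddly_good a b 1 by split=> //; exists 1%N; split; rewrite ?dvd1z.
have ogd : oddly_good a b (2 ^ beta * d) -> oddly_good a b d.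
  case=> _ [k [k1 ok]]; rewrite dvdz_pow2_mul // => /andP[_ dk].
  by split; [exact: odd_gt0 | exists k].
split=> hp.
  have [a2 b2] : ~~ (2 %| a)%Z /\ ~~ (2 %| b)%Z.
    by apply/andP; rewrite -negb_or -dvd2z_mul.
  have lift : ((2 ^ beta)%N%:Z %| a + b)%Z -> oddly_good a b d ->
      oddly_good a b (2 ^ beta * d).
    move=> Hb [_ [k [k1 ok dk]]]; split=> //; exists k; split=> //.
    by rewrite dvdz_pow2_mul // dvdz_pow2_sum // Hb.
  (* As [a + b] is even, cases (a) and (b) also satisfy the divisibility required in (c) and (d). *)
  have small : beta = 0%N \/ beta = 1%N -> ((2 ^ beta)%N%:Z %| a + b)%Z.
    case=> ->; first by rewrite dvd1z.
    by rewrite dvd2z_add (negbTE a2) (negbTE b2).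
  split=> [og|].
    have /ogd og' := og; case: og => _ [k [k1 ok]].
    rewrite dvdz_pow2_mul // dvdz_pow2_sum // => /andP[Hb dk].
    have betaP : (beta = 0%N \/ beta = 1%N) \/ (2 <= beta)%N.
      by case: (beta) => [|[]]; auto.
    case: betaP d1or => hbeta [d1|d3].
    - by constructor 1.
    - by constructor 2; split=> // p; apply: oddly_good_odd_primes og'.
    - by constructor 3.
    - constructor 4; split=> //; split; last exact: two_exact_ord_odd_sum dk.
      by split; [exact: odd_gt0 | exists k].
  case=> [[/small Hb d1]|[/small Hb _ H]|[_ d1 Hb]|[_ d3 Hb [[d0 [k [k1 dk]]] H]]];
    apply: lift => //; try by rewrite d1.
  - exact: odd_primes_oddly_good.
  (* Goodness of [d] gives an exponent of unknown parity; the order of [a/b] modulo [d] forces it to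
     be odd. *)
  - split=> //; exists k; split=> //; exact: two_exact_ord_sum_odd dk.
(* By coprimality exactly one of [a], [b] is even. *)
have ab2 : ~~ (2 %| a + b)%Z.
  rewrite dvd2z_add; move: hp; rewrite dvd2z_mul.
  case: (boolP (2 %| a)%Z) (boolP (2 %| b)%Z) => [a2|_] [b2|_] // _.
  have : (2 %| gcdz a b)%Z by rewrite dvdz_gcd a2.
  by move/eqP: hab => ->.
split=> [og|].
  have /ogd og' := og; case: og => _ [k [k1 ok]].
  rewrite dvdz_pow2_mul // => /andP[Hb _].
  (* A positive [beta] would make [a^k + b^k] even, yet it has the parity of [a + b]. *)
  have b0 : beta = 0%N.
    case: (beta) Hb => // n Hb; case/negP: ab2.
    rewrite dvd2z_add -(dvd2z_exp a k1) -(dvd2z_exp b k1) -dvd2z_add.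
    by apply: dvdz_trans Hb; rewrite dvdzE /= expnS dvdn_mulr.
  case: d1or => [d1|d3]; [by left | right].
  by split=> // p; apply: oddly_good_odd_primes og'.
case=> [[-> ->]|[-> _ H]]; rewrite mul1n //; exact: odd_primes_oddly_good.
Qed.
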